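(* The set $\mathcal{F}_{C_3+P_1}$ has infinitely many non-isomorphic graphs.
   Context: Graphs are finite, without loops or multiple edges. For a vertex $u$ of a graph $G$, the local complementation $G*u$ is obtained from $G$ by complementing the adjacency between every pair of distinct neighbours of $u$. For an edge $uv$ of $G$, the edge pivot is $G\wedge uv=((G*u)*v)*u$. A graph $G$ contains $H$ as a pivot-minor if $H$ can be obtained from $G$ by a sequence of vertex deletions and edge pivots. For a graph $H$, $\mathcal{F}_H$ is the set of induced-subgraph-minimal graphs containing a pivot-minor isomorphic to $H$: a graph $F$ is in $\mathcal{F}_H$ if and only if $F$ contains a pivot-minor isomorphic to $H$ but no proper induced subgraph of $F$ does. $C_3+P_1$ is the disjoint union of a triangle and an isolated vertex. *)

(* Defs.v *)
From mathcomp Require Import all_boot.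

Set Implicit Arguments.
Unset Strict Implicit.
Unset Printing Implicit Defensive.

Record sgraph := SGraph {
  vertex :> finType;
  edge : rel vertex;
  edge_sym : symmetric edge;
  edge_irrefl : irreflexive edge }.

Arguments edge {s}.

Definition isomorphic (G H : sgraph) : Prop :=
  exists2 f : G -> H, bijective f & {mono f : x y / edge x y}.

Section Operations.
Variable G : sgraph.

Definition lc_rel (u : G) : rel G := fun x y =>
  (x != y) && (edge x y (+) (edge u x && edge u y)).

Lemma lc_sym u : symmetric (lc_rel u).
Proof. by move=> x y; rewrite /lc_rel eq_sym edge_sym andbC [edge u x && _]andbC andbC. Qed.

Lemma lc_irrefl u : irreflexive (lc_rel u).
Proof. by move=> x; rewrite /lc_rel eqxx. Qed.

Definition local_complement (u : G) : sgraph :=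
  SGraph (lc_sym u) (lc_irrefl u).

Definition induced_rel (S : {set G}) : rel {x : G | x \in S} :=
  fun x y => edge (val x) (val y).

Lemma induced_sym S : symmetric (@induced_rel S).
Proof. by move=> x y; exact: edge_sym. Qed.

Lemma induced_irrefl S : irreflexive (@induced_rel S).
Proof. by move=> x; exact: edge_irrefl. Qed.

Definition induced (S : {set G}) : sgraph :=
  SGraph (@induced_sym S) (@induced_irrefl S).

Definition delete_vertex (u : G) : sgraph := induced [set~ u].

End Operations.

(* Each local complementation keeps the vertex type up to conversion, so that
   u and v can be reused as vertices of the successive graphs. *)
Definition pivot (G : sgraph) (u v : G) : sgraph :=
  @local_complement (@local_complement (@local_complement G u) v) u.

Inductive pivot_reduces : sgraph -> sgraph -> Prop :=
| pivot_reduces_refl (G : sgraph) : pivot_reduces G G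
| pivot_reduces_delete (G : sgraph) (u : G) (K : sgraph) :
    pivot_reduces (delete_vertex u) K -> pivot_reduces G K
| pivot_reduces_pivot (G : sgraph) (u v : G) (K : sgraph) :
    edge u v -> pivot_reduces (pivot u v) K -> pivot_reduces G K.

Definition has_pivot_minor (G H : sgraph) : Prop :=
  exists2 K, pivot_reduces G K & isomorphic K H.

(* [minimal_containing H F]: F belongs to F_H. *)
Definition minimal_containing (H F : sgraph) : Prop :=
  has_pivot_minor F H /\
  forall S : {set F}, S \proper [set: F] -> ~ has_pivot_minor (induced S) H.

Section Constructions.

Definition complete_rel n : rel 'I_n := fun x y => x != y.

Lemma complete_sym n : symmetric (@complete_rel n).
Proof. by move=> x y; rewrite /complete_rel eq_sym. Qed.

Lemma complete_irrefl n : irreflexive (@complete_rel n).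
Proof. by move=> x; rewrite /complete_rel eqxx. Qed.

Definition complete_graph n : sgraph :=
  SGraph (@complete_sym n) (@complete_irrefl n).

Variables G H : sgraph.

Definition union_rel : rel (G + H)%type := fun x y =>
  match x, y with
  | inl a, inl b => edge a b
  | inr a, inr b => edge a b
  | _, _ => false
  end.

Lemma union_sym : symmetric union_rel.
Proof. by move=> [a|a] [b|b] //=; exact: edge_sym. Qed.

Lemma union_irrefl : irreflexive union_rel.
Proof. by move=> [a|a] /=; exact: edge_irrefl. Qed.

Definition disjoint_union : sgraph := SGraph union_sym union_irrefl.

End Constructions.

Definition C3_P1 : sgraph :=
  disjoint_union (complete_graph 3) (complete_graph 1).

(* Main.v *)
(* The witnesses are the graphs C_n + P_1 with n >= 3 odd: pivoting an edge of
   C_(n+2) and deleting its ends gives C_n. For minimality, the row space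
   {(x, A x)} of [I | A] over GF(2) is followed through pivots and deletions:
   every vector of it for a pivot-minor K lifts to one for G, up to swapping
   coordinates. If the lifts of the three corners of a triangle vanish at some
   v with G - v bipartite, then the bilinear form pairing x with A x on one
   colour class and A x with x on the other vanishes on these lifts, and yields
   a proper 2-colouring of the triangle. Such a v is any cycle vertex deleted.
   If only P_1 is deleted, let D be the lift of the isolated vertex: A D <> 0
   since the kernel of an odd cycle contains only constant vectors and D
   vanishes at the corners; any v with (A D)_v = 1 then works. *)

Require Import Defs.
From mathcomp Require Import all_boot.
From mathcomp Require Import zify.

Set Implicit Arguments.
Unset Strict Implicit.
Unset Printing Implicit Defensive.

(** * Adjacency sums over GF(2) under local complementation and pivoting *)

Definition nbr_sum (G : sgraph) (X : G -> bool) (v : G) : bool :=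
  \big[addb/false]_z (edge v z && X z).

Lemma nbr_sum_pred1 (G : sgraph) (u v : G) : nbr_sum (pred1 u) v = edge v u.
Proof.
rewrite /nbr_sum (bigD1 u) //= eqxx andbT big1 ?addbF // => z /negPf ->.
by rewrite andbF.
Qed.

Lemma nbr_sum2 (G : sgraph) (X : G -> bool) (v a b : G) :
  a != b -> (forall z, edge v z = (z == a) || (z == b)) ->
  nbr_sum X v = X a (+) X b.
Proof.
move=> ab nv; rewrite /nbr_sum (bigD1 a) //= (bigD1 b) 1?eq_sym //=.
rewrite !nv !eqxx orbT big1 ?addbF //= => z /andP[/negPf za /negPf zb].
by rewrite nv za zb.
Qed.

Lemma edge_lc (G : sgraph) (u v w : G) : @edge (local_complement u) v w =
  (v != w) && (edge v w (+) (edge u v && edge u w)).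
Proof. by []. Qed.

Lemma edge_lc_center (G : sgraph) (u w : G) :
  @edge (local_complement u) u w = edge u w.
Proof.
rewrite edge_lc edge_irrefl addbF; have [->|//] := eqVneq u w.
by rewrite edge_irrefl.
Qed.

(* A local complementation at [u] changes the pair (X w, nbr_sum X w) by a
   transvection at [u] and at each neighbour of [u]. *)
Lemma nbr_sum_lc (G : sgraph) (u : G) (X : local_complement u -> bool) w :
  nbr_sum (G := G) (fun w => X w (+) (w == u) && nbr_sum X u) w =
  nbr_sum X w (+) edge u w && X w.
Proof.
set s := nbr_sum X u; rewrite {1 2}/nbr_sum.
have E (z : G) : edge w z && (X z (+) (z == u) && s) =
   (@edge (local_complement u) w z && X z) (+)
   (edge u w && (@edge (local_complement u) u z && X z)) (+)
   ((edge u w && X w) && (z == w)) (+) ((edge w u && s) && (z == u)).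
  rewrite edge_lc_center edge_lc; have [->|zw] := eqVneq w z.
    rewrite edge_irrefl /= !andbT; have [->|] := eqVneq z u.
      by rewrite edge_irrefl.
    by rewrite !andbF; case: (edge u z); case: (X z).
  rewrite /= !andbF; have [->|zu] := eqVneq z u.
    by rewrite edge_irrefl !andbF /= !andbT; case: (edge w u); case: (X u);
       case: s.
  by rewrite !andbF; case: (edge w z); case: (edge u w); case: (edge u z);
     case: (X z).
rewrite (eq_bigr _ (fun z _ => E z)) !big_split /= -!big_distrr /=.
have big1eq (a : G) : \big[addb/false]_(z : G) (z == a) = true.
  by rewrite (bigD1 a) //= eqxx big1 // => z /negPf.
rewrite !big1eq !andbT -/(nbr_sum X u) -/s [edge w u]edge_sym.
by case: (edge u w); case: (s); case: (X w); case: (\big[_/_]_z _).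
Qed.

(** For distinct [w] and [z] this is the Schur complement over GF(2) of the block of A at [u] and
    [v]. *)
Lemma edge_pivot (G : sgraph) (u v w z : G) : edge u v ->
  w != u -> w != v -> z != u -> z != v ->
  @edge (pivot u v) w z = (w != z) &&
    (edge w z (+) (edge u w && edge v z) (+) (edge v w && edge u z)).
Proof.
move=> uv wu wv zu zv; have nuv: u != v.
  by apply: contraTneq uv => ->; rewrite edge_irrefl.
rewrite /pivot !edge_lc !edge_irrefl !(edge_sym v u) uv.
rewrite ![v == _]eq_sym ![u == _]eq_sym (eq_sym v u).
rewrite (negPf wu) (negPf wv) (negPf zu) (negPf zv) (negPf nuv) /=.
by case: (w != z) => //=; case: (edge w z); case: (edge u w); case: (edge v z);
  case: (edge v w); case: (edge u z).
Qed.

(** The three transvections compose to a swap at [u] and at [v]; at any other vertex their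
    contributions cancel. *)
Lemma nbr_sum_pivot (G : sgraph) (u v : G) (X : pivot u v -> bool) :
  edge u v ->
  exists X' : G -> bool, forall w,
    (X' w, nbr_sum X' w) =
    if (w == u) || (w == v) then (nbr_sum X w, X w) else (X w, nbr_sum X w).
Proof.
move=> uv; have nuv: u != v.
  by apply: contraTneq uv => ->; rewrite edge_irrefl.
pose X2 : @local_complement (local_complement u) v -> bool :=
  fun w => X w (+) (w == u) && nbr_sum X u.
pose X1 : local_complement u -> bool :=
  fun w => X2 w (+) (w == v) && nbr_sum X2 v.
pose X0 : G -> bool := fun w => X1 w (+) (w == u) && nbr_sum X1 u.
exists X0 => w.
have N2 z := nbr_sum_lc X z : nbr_sum X2 z = _.
have N1 z := nbr_sum_lc X2 z : nbr_sum X1 z = _.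
have N0 z := nbr_sum_lc X1 z : nbr_sum X0 z = _.
rewrite N0 /X0 !N1 /X1 !N2 /X2.
rewrite !edge_lc !edge_irrefl !(edge_sym v u) uv !eqxx (eq_sym v u).
rewrite (negPf nuv) /=.
have [->|wu] := eqVneq w u.
  rewrite (eq_sym v u) (negPf nuv) edge_irrefl (edge_sym v u) uv /=.
  by case: (X u); case: (nbr_sum X u); case: (X v); case: (nbr_sum X v).
have [->|wv] := eqVneq w v.
  rewrite uv edge_irrefl /=.
  by case: (X u); case: (nbr_sum X u); case: (X v); case: (nbr_sum X v).
rewrite /=; congr pair.
  by rewrite !addbF.
by case: (edge u w); case: (edge v w); case: (X w); case: (nbr_sum X w).
Qed.

(** * Lifting row-space vectors from pivot-minors *)

(* The pairs (x, A x) form the row space of [I | A]; [K] arises from [G] by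
   swapping the two coordinates at the vertices marked by [t] and then
   restricting to the pairs whose first coordinate vanishes off [f K]. *)
Definition lifts (G K : sgraph) (f : K -> G) (t : G -> bool)
    (x : K -> bool) (X : G -> bool) : Prop :=
  (forall k, (X (f k), nbr_sum X (f k)) =
     if t (f k) then (nbr_sum x k, x k) else (x k, nbr_sum x k)) /\
  (forall v, v \notin codom f -> (if t v then nbr_sum X v else X v) = false).

Definition liftable (G K : sgraph) (f : K -> G) (t : G -> bool) : Prop :=
  injective f /\ forall x, exists X, lifts f t x X.

Definition extend_val (G : sgraph) (S : {set G}) (X : induced S -> bool)
  (v : G) : bool := if insub v is Some w then X w else false.

Lemma nbr_sum_extend (G : sgraph) (S : {set G}) (X : induced S -> bool) w :
  nbr_sum (extend_val X) (val w) = nbr_sum X w.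
Proof.
rewrite /nbr_sum (bigID (mem S)) /= [X in _ (+) X]big1 ?addbF; last first.
  by move=> z zS; rewrite /extend_val insubN // andbF.
rewrite (reindex_onto val (fun z => insubd w z)) /=; last first.
  by move=> z zS; rewrite insubdK.
apply: eq_big => z; first by rewrite valKd eqxx (valP z).
by rewrite /extend_val valK.
Qed.

Lemma liftable_induced (G K : sgraph) (S : {set G}) (f : K -> induced S) t :
  liftable f t -> liftable (val \o f) (extend_val t).
Proof.
case=> injf ht; split; first exact: inj_comp val_inj injf.
move=> x; have [X [h1 h2]] := ht x; exists (extend_val X); split=> [k|v].
  by rewrite /= nbr_sum_extend /extend_val !valK h1.
move=> vf; rewrite {1 3}/extend_val; case: insubP => [w _ wv|//].
rewrite -wv nbr_sum_extend h2 //; apply: contra vf => /codomP[k wk].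
by apply/codomP; exists k; rewrite -wv wk.
Qed.

Lemma pivot_reduces_liftable (G K : sgraph) :
  pivot_reduces G K -> exists f t, @liftable G K f t.
Proof.
elim=> {G K} [G|G u K _ [f [t ft]]|G u v K uv _ [f [t [injf ft]]]].
- exists id, (fun _ => false); split=> // x; exists x; split=> // v.
  by rewrite -[v]/(id v) codom_f.
- by exists (val \o f), (extend_val t); apply: liftable_induced.
(* The pivot swaps coordinates at [u] and [v], so it toggles their marks. *)
exists f, (fun w => t w (+) ((w == u) || (w == v))); split=> // x.
have [X [h1 h2]] := ft x; have [X' hX] := nbr_sum_pivot X uv.
exists X'; split=> [k|w wf].
  rewrite hX; have := h1 k.
  by case: (_ || _); case: (t (f k)) => -[-> ->].
have := h2 w wf; have := hX w.
by case: (_ || _); case: (t w) => /= -[e1 e2]; rewrite ?e1 ?e2.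
Qed.

Lemma liftable_isomorphic (G K H : sgraph) (f : K -> G) t :
  liftable f t -> isomorphic K H -> exists g : H -> G, liftable g t.
Proof.
case=> injf ft [h [h' hK h'K] hm]; exists (f \o h'); split.
  exact: inj_comp injf (can_inj h'K).
move=> x; have [X [h1 h2]] := ft (x \o h); exists X; split=> [k|v vf].
  rewrite /= h1 /= h'K; suff -> : nbr_sum (x \o h) (h' k) = nbr_sum x k by [].
  rewrite /nbr_sum (reindex h) /=; last by exists h' => z _.
  by apply: eq_bigr => z _; rewrite -{2}[k]h'K hm.
apply: h2; apply: contra vf => /codomP[k ->].
by apply/codomP; exists (h k); rewrite /= hK.
Qed.

(* If the colour classes of [chi] cover G - v properly, the sum of
   X w (A Z) w over one class equals that of (A X) w Z w over the other. *)
Lemma lifts_coloring (G K : sgraph) (f : K -> G) (t chi : G -> bool) (v : G)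
    (i j : K) (X Z : G -> bool) :
  injective f ->
  (forall w z, w != v -> z != v -> edge w z -> chi w != chi z) ->
  lifts f t (pred1 i) X -> lifts f t (pred1 j) Z ->
  X v = false -> Z v = false -> edge i j ->
  chi (f i) (+) t (f i) != chi (f j) (+) t (f j).
Proof.
move=> injf chiP [X1 X2] [Z1 Z2] Xv Zv ij.
have nij : i != j by apply: contraTneq ij => ->; rewrite edge_irrefl.
pose F w := if chi w then X w && nbr_sum Z w else nbr_sum X w && Z w.
(* After exchanging the sums of [U], [T] and [U] cancel on each edge: off [v] its ends have opposite
   colours, and at [v] one of [X], [Z] vanishes. *)
have sumF : \big[addb/false]_w F w = false.
  pose T w z := chi w && (edge w z && X w && Z z).
  pose U w z := ~~ chi z && (edge w z && X w && Z z).
  have FE w : F w = \big[addb/false]_z (T w z (+) U z w).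
    rewrite /F /T /U; case: (chi w); rewrite /nbr_sum
      ?big_distrl ?big_distrr /=;
      apply: eq_bigr => z _ /=; rewrite ?addbF.
      by rewrite andbCA andbA.
    by rewrite edge_sym.
  rewrite (eq_bigr _ (fun w _ => FE w)).
  under eq_bigr => w _ do rewrite big_split /=.
  rewrite big_split /= [X in _ (+) X]exchange_big /= -big_split /=.
  rewrite big1 // => w _.
  rewrite -big_split /= big1 // => z _; rewrite /T /U.
  have [wz|] := boolP (edge w z); last by rewrite !andbF.
  have [wv|wv] := eqVneq w v; first by rewrite wv Xv !andbF.
  have [zv|zv] := eqVneq z v; first by rewrite zv Zv !andbF.
  have := chiP w z wv zv wz; case: (chi w); case: (chi z) => //= _.
  by rewrite addbb.
move: sumF; rewrite (bigD1 (f i)) //= (bigD1 (f j)) /=; last first.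
  by rewrite inj_eq // eq_sym.
(* Elsewhere [X] and [Z] have a zero in the same coordinate. The two terms left are
   [chi (f i) (+) t (f i)] and the negation of [chi (f j) (+) t (f j)]. *)
rewrite big1 => [|w /andP[wi wj]]; last first.
  have [/codomP[k wk]|wf] := boolP (w \in codom f).
    move: (X1 k) (Z1 k) wi wj; rewrite /F -wk /= wk !inj_eq //.
    move=> + + /negPf ki /negPf kj; rewrite /= ki kj.
    by case: (t _) => -[-> ->] [-> ->]; rewrite ?andbF if_same.
  have := X2 w wf; have := Z2 w wf; rewrite /F.
  by case: (t w) => -> ->; rewrite ?andbF if_same.
move: (X1 i) (X1 j) (Z1 i) (Z1 j); rewrite !nbr_sum_pred1 /= !eqxx.
rewrite [j == i]eq_sym (negPf nij) !edge_irrefl [edge j i]edge_sym ij.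
rewrite /F => Xi Xj Zi Zj.
case: (t (f i)) Xi Zi => -[-> ->] [-> ->];
case: (t (f j)) Xj Zj => -[-> ->] [-> ->];
by case: (chi (f i)); case: (chi (f j)).
Qed.

(** * Pivot-minors of induced subgraphs *)

Lemma induced_embedding_reduces (n : nat) (K G : sgraph) (f : K -> G) :
  #|G| <= n -> injective f -> {mono f : x y / edge x y} ->
  exists2 K', pivot_reduces G K' & isomorphic K' K.
Proof.
elim: n K G f => [|n IHn] K G f leGn injf monof.
  have G0 (v : G) : False.
    by have := leq_trans (max_card (pred1 v)) leGn; rewrite card1.
  exists G; first exact: pivot_reduces_refl.
  exists (fun v => False_rect K (G0 v)) => [|v]; last by case: (G0 v).
  by exists f => [v|x]; [case: (G0 v)|case: (G0 (f x))].
have [/existsP[u uf]|] := boolP [exists u, u \notin codom f]; last first.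
  rewrite negb_exists => /forallP onto_f.
  have fP v : v \in codom f by rewrite -[_ \in _]negbK onto_f.
  exists G; first exact: pivot_reduces_refl.
  exists (fun v => iinv (fP v)) => [|x y]; last by rewrite -monof !f_iinv.
  by exists f => [v|x]; [exact: f_iinv|apply: injf; rewrite f_iinv].
have fu x : f x \in [set~ u].
  by rewrite !inE; apply: contraNneq uf => <-; exact: codom_f.
have [||x y|K' redK' isoK'] :=
    IHn K (delete_vertex u) (fun x => exist _ (f x) (fu x)).
- by rewrite card_sig (eq_card (_ : _ =i [set~ u])) // cardsC1; lia.
- by move=> x y /(congr1 val) /injf.
- exact: monof.
by exists K' => //; exact: pivot_reduces_delete redK'.
Qed.

(** Pivots are copied along [f], which stays an induced embedding. A deletion only restricts [f];
    surplus vertices of [G'] are deleted at the end. *)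
Lemma pivot_reduces_embedding (G K : sgraph) : pivot_reduces G K ->
  forall (G' : sgraph) (f : G -> G'), injective f ->
    {mono f : x y / edge x y} ->
  exists2 K', pivot_reduces G' K' & isomorphic K' K.
Proof.
elim=> {G K} [G|G u K _ IH|G u v K uv _ IH] G' f injf monof.
- exact: (@induced_embedding_reduces #|G'|) injf monof.
- apply: (IH G' (f \o val)); first exact: inj_comp injf val_inj.
  by move=> x y; rewrite /= monof.
have [x y|K' redK' isoK'] := IH (pivot (f u) (f v)) f injf.
  by rewrite /pivot !edge_lc !monof !inj_eq.
by exists K' => //; apply: pivot_reduces_pivot redK'; rewrite monof.
Qed.

Lemma isomorphic_trans (G H K : sgraph) :
  isomorphic G H -> isomorphic H K -> isomorphic G K.
Proof.
case=> f bijf monof [g bijg monog]; exists (g \o f); first exact: bij_comp.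
by move=> x y; rewrite /= monog monof.
Qed.

Lemma has_pivot_minor_embedding (G G' H : sgraph) (f : G -> G') :
  injective f -> {mono f : x y / edge x y} ->
  has_pivot_minor G H -> has_pivot_minor G' H.
Proof.
move=> injf monof [K redK isoK].
have [K' redK' isoK'] := pivot_reduces_embedding redK injf monof.
by exists K' => //; exact: isomorphic_trans isoK' isoK.
Qed.

(** * Odd cycles with an isolated vertex *)

Definition cycle_edge (n i j : nat) : bool :=
  [&& i < n, j < n &
    [|| j == i.+1, i == j.+1, (i == 0) && (j.+1 == n)
      | (j == 0) && (i.+1 == n)]].

(** The pair toggled by pivoting the edge between n and n+1 of C_(n+2) is that of their outer
    neighbours n-1 and 0, which closes C_n. *)
Lemma cycle_edge_shorten n a b : 2 < n -> a < n -> b < n ->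
  cycle_edge n a b = (a != b) && (cycle_edge n.+2 a b
    (+) ((a.+1 == n) && (b == 0)) (+) ((a == 0) && (b.+1 == n))).
Proof.
move=> n2 an bn; rewrite /cycle_edge an bn.
have -> : a < n.+2 by lia.
have -> : b < n.+2 by lia.
have -> : (a.+1 == n.+2) = false by lia.
have -> : (b.+1 == n.+2) = false by lia.
rewrite !andbF !orbF /=.
have [->|ab] := eqVneq a b; first lia.
have [a0|a0] := eqVneq a 0; have [b0|b0] := eqVneq b 0;
have [a1|a1] := eqVneq a.+1 n; have [b1|b1] := eqVneq b.+1 n;
rewrite /= ?andbF ?andbT ?orbF ?addbF ?orbT //=; lia.
Qed.

Section OddCycle.

Variable m : nat.
Local Notation n := m.*2.+3.

Definition cycle_P1_rel : rel 'I_n.+1 := fun i j => cycle_edge n i j.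

Lemma cycle_P1_sym : symmetric cycle_P1_rel.
Proof. by move=> i j; rewrite /cycle_P1_rel /cycle_edge; lia. Qed.

Lemma cycle_P1_irrefl : irreflexive cycle_P1_rel.
Proof. by move=> i; rewrite /cycle_P1_rel /cycle_edge; lia. Qed.

(* [ord_max] is the isolated vertex. *)
Definition cycle_P1 : sgraph := SGraph cycle_P1_sym cycle_P1_irrefl.

(** Parity fails only on the edge between 0 and n-1, both even. Flipping it below [v] repairs that
    edge, unless [v] is an end, and otherwise affects only edges at [v]. *)
Lemma cycle_P1_coloring (v : cycle_P1) : v < n ->
  forall w z : cycle_P1, w != v -> z != v -> edge w z ->
  odd w (+) (w < v) != odd z (+) (z < v).
Proof.
move=> vn w z; rewrite -!val_eqE /= /cycle_P1_rel /cycle_edge => wv zv.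
wlog : w z wv zv / (val z == w.+1) || (val w == 0) && (z.+1 == n).
  move=> wlog_wz; case/and3P=> wn zn /or4P[] wz.
  - by apply: wlog_wz; rewrite ?wn ?zn ?wz.
  - by rewrite eq_sym; apply: wlog_wz; rewrite ?wn ?zn ?wz ?orbT.
  - by apply: wlog_wz; rewrite ?wn ?zn ?wz ?orbT.
  by rewrite eq_sym; apply: wlog_wz; rewrite ?wn ?zn ?wz ?orbT.
case/orP=> /=[/eqP zE _|/andP[/eqP w0 /eqP[zE]] _].
  have -> : (w < v) = (z < v) by move: zv; rewrite zE [RHS]ltn_neqAle => ->.
  by rewrite zE /=; case: (odd w); case: (_ < _).
move: vn wv zv; rewrite w0 zE => vn wv zv.
have -> : (m.*2.+2 < v) = false by lia.
have -> : 0 < v by lia.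
by rewrite /= odd_double.
Qed.

(** A zero sum at i+1 equates the values at i and i+2; the sum at 0 links the odd index 1 to the
    even index n-1. *)
Lemma cycle_P1_kernel (X : cycle_P1 -> bool) :
  (forall v, nbr_sum X v = false) ->
  forall v w : cycle_P1, v < n -> w < n -> X v = X w.
Proof.
move=> X0; pose Y (i : nat) := X (inord i).
have step i : i.+2 < n -> Y i.+2 = Y i.
  move=> lti; have := X0 (inord i.+1).
  rewrite (@nbr_sum2 cycle_P1 X _ (inord i) (inord i.+2)).
  - by rewrite -/(Y i) -/(Y i.+2); case: (Y i); case: (Y i.+2).
  - by rewrite -val_eqE /= !inordK; lia.
  move=> z; rewrite /= /cycle_P1_rel /cycle_edge -!val_eqE /= !inordK; lia.
have wrap : Y 1 = Y n.-1.
  have := X0 (inord 0).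
  rewrite (@nbr_sum2 cycle_P1 X _ (inord 1) (inord n.-1)).
  - by rewrite -/(Y 1) -/(Y n.-1); case: (Y 1); case: (Y n.-1).
  - by rewrite -val_eqE /= !inordK; lia.
  move=> z; rewrite /= /cycle_P1_rel /cycle_edge -!val_eqE /= !inordK; lia.
have ev k : k.*2 < n -> Y k.*2 = Y 0.
  elim: k => // k IHk ltk; rewrite doubleS step -?doubleS // IHk //; lia.
have od k : k.*2.+1 < n -> Y k.*2.+1 = Y 1.
  elim: k => // k IHk ltk; rewrite doubleS step -?doubleS // IHk //; lia.
have Y10 : Y 1 = Y 0 by rewrite wrap (ev m.+1) //; lia.
suff Y0 (v : cycle_P1) : v < n -> X v = Y 0 by move=> v w *; rewrite !Y0.
move=> vn; rewrite -[v]inord_val -/(Y v) -[v : nat]odd_double_half.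
have := odd_double_half v; case: (odd v) => /= E; last by rewrite ev //; lia.
by rewrite add1n od //; lia.
Qed.

End OddCycle.

(** * The pivot-minor C_3 + P_1 in each odd cycle plus P_1 *)

Lemma cycle_P1_shorten m (H : sgraph) :
  has_pivot_minor (cycle_P1 m) H -> has_pivot_minor (cycle_P1 m.+1) H.
Proof.
move=> minH.
have [u uE] : exists u : cycle_P1 m.+1, u = m.*2.+3 :> nat.
  by exists (inord m.*2.+3); rewrite inordK //; lia.
have [v vE] : exists v : cycle_P1 m.+1, v = m.*2.+4 :> nat.
  by exists (inord m.*2.+4); rewrite inordK //; lia.
have uv : edge u v by rewrite /= /cycle_P1_rel /cycle_edge uE vE; lia.
(* Cycle vertices keep their index; the isolated vertex jumps over [u] and [v] to the new isolated
   one. *)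
have [f fE] : exists f : cycle_P1 m -> pivot u v, forall i,
    f i = (if i < m.*2.+3 then i : nat else m.+1.*2.+3) :> nat.
  exists (fun i : cycle_P1 m =>
    inord (if i < m.*2.+3 then i : nat else m.+1.*2.+3)) => i.
  by rewrite inordK //; have := ltn_ord i; case: ifP; lia.
have injf : injective f.
  move=> i j /(congr1 val) /=; rewrite !fE => E; apply: val_inj => /=.
  move: E (ltn_ord i) (ltn_ord j); move: (nat_of_ord i) (nat_of_ord j) => a b.
  by clear; case: ltnP => aP; case: ltnP => bP; lia.
have nu a : a != m.*2.+4 -> cycle_edge m.+1.*2.+3 m.*2.+3 a = (a == m.*2.+2).
  by clear; rewrite /cycle_edge; lia.
have nv a : a != m.*2.+3 -> cycle_edge m.+1.*2.+3 m.*2.+4 a = (a == 0).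
  by clear; rewrite /cycle_edge; lia.
have monof : {mono f : i j / edge i j}.
  move=> i j; rewrite edge_pivot -?val_eqE /= ?fE ?uE ?vE //;
    try by clear; case: ifP; lia.
  rewrite /cycle_P1_rel uE vE !fE.
  move: (ltn_ord i) (ltn_ord j); move: (nat_of_ord i) (nat_of_ord j) => a b.
  move=> lta ltb; rewrite !nu ?nv; try by clear; case: ifP; lia.
  clear -lta ltb.
  case: (ltnP a) => aP; case: (ltnP b) => bP.
  - rewrite [in RHS]cycle_edge_shorten //.
  - by rewrite /cycle_edge ltnn andbF /=; lia.
  - by rewrite /cycle_edge ltnn /=; lia.
  - by rewrite eqxx /cycle_edge; lia.
have [K redK isoK] := has_pivot_minor_embedding injf monof minH.
by exists K => //; exact: pivot_reduces_pivot redK.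
Qed.

Lemma cycle_P1_0 : isomorphic (cycle_P1 0) C3_P1.
Proof.
exists (@split 3 1).
  by exists (@unsplit 3 1); [exact: splitK|exact: unsplitK].
move=> i j; rewrite [RHS]/= /cycle_P1_rel.
case: (@splitP 3 1 i) => a ->; case: (@splitP 3 1 j) => b ->;
  rewrite /= /complete_rel -?val_eqE /= /cycle_edge.
- move: (ltn_ord a) (ltn_ord b); move: (nat_of_ord a) (nat_of_ord b).
  by case=> [|[|[|//]]] [|[|[|//]]].
- by rewrite [_ + b < _]ltnNge leq_addr andbF.
- by rewrite ltnNge leq_addr.
by rewrite [a]ord1 [b]ord1.
Qed.

Lemma has_pivot_minor_cycle_P1 m : has_pivot_minor (cycle_P1 m) C3_P1.
Proof.
elim: m => [|m IHm]; last exact: cycle_P1_shorten.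
by exists (cycle_P1 0); [exact: pivot_reduces_refl|exact: cycle_P1_0].
Qed.


(** * Minimality *)

Lemma cycle_P1_proper_induced m (S : {set cycle_P1 m}) :
  S \proper [set: cycle_P1 m] -> ~ has_pivot_minor (induced S) C3_P1.
Proof.
rewrite properT => /eqP ST [K redK isoK].
have [f0 [t0 lift0]] := pivot_reduces_liftable redK.
have {isoK lift0} [g0 lift0] := liftable_isomorphic lift0 isoK.
have := liftable_induced lift0.
set f := val \o g0; set t := extend_val t0 => -[injf liftf].
have fS k : f k \in S by exact: (valP (g0 k)).
have lifts_out x X v : lifts f t x X -> v \notin S -> X v = false.
  move=> [_ X0] vS; have := X0 v; rewrite /t /extend_val insubN //; apply.
  by apply: contra vS => /codomP[k ->].
pose corner (i : 'I_3) : C3_P1 := inl i.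
(* A cycle vertex [v] at which the lifts of the three corners vanish leads to
   a contradiction, since the graph without [v] is bipartite. *)
have missing (v : cycle_P1 m) : v < m.*2.+3 ->
    (forall i X, lifts f t (pred1 (corner i)) X -> X v = false) -> False.
  move=> vn Xv.
  pose col i :=
    (odd (f (corner i)) (+) (f (corner i) < v)) (+) t (f (corner i)).
  have neq i j : i != j -> col i != col j.
    move=> ij; have [X hX] := liftf (pred1 (corner i)).
    have [Z hZ] := liftf (pred1 (corner j)).
    exact: (lifts_coloring injf (cycle_P1_coloring vn) hX hZ
              (Xv _ _ hX) (Xv _ _ hZ)).
  have neqn (i j : nat) : i < 3 -> j < 3 -> i != j ->
      col (inord i) != col (inord j).
    by move=> i3 j3 ij; apply: neq; rewrite -val_eqE /= !inordK.
  (* Three booleans cannot be pairwise distinct. *)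
  have := (neqn 0 1 isT isT isT, neqn 1 2 isT isT isT, neqn 0 2 isT isT isT).
  by case: (col _) (col _) (col _) => [] [] [] [[]].
have [/existsP[v /andP[vS vn]]|] :=
    boolP [exists v : cycle_P1 m, (v \notin S) && (v < m.*2.+3)].
  by apply: (missing v vn) => i X hX; exact: lifts_out hX vS.
rewrite negb_exists => /forallP cycleS.
have outS v : v \notin S -> v < m.*2.+3 = false.
  by move=> vS; have := cycleS v; rewrite vS /= => /negPf.
(* The only vertex off the cycle must be the one missing from [S]. *)
have inS v : v \in S -> v < m.*2.+3.
  move=> vS; apply/negPn/negP => vn; apply: ST; apply/setP => w; rewrite inE.
  apply/negPn/negP => wS; case/negP: (wS); suff -> : w = v by [].
  apply: val_inj => /=; move: (outS w wS) (negPf vn) (ltn_ord v) (ltn_ord w).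
  by move: (nat_of_ord v) (nat_of_ord w) => a b; clear; lia.
pose d : C3_P1 := inr ord0; have [D hD] := liftf (pred1 d).
have nd k : edge k d = false.
  by case: k => // j; rewrite [j]ord1; exact: edge_irrefl.
have D_corner i : (D (f (corner i)), nbr_sum D (f (corner i))) = (false, false).
  by case: hD => hD _; rewrite hD nbr_sum_pred1 nd if_same.
have [/existsP[v vD]|] := boolP [exists v, nbr_sum D v].
  apply: (missing v) => [|i X [X1 X2]].
    rewrite ltnNge; apply: contraL vD => vn; rewrite /nbr_sum big1 // => z _.
    by rewrite /edge /= /cycle_P1_rel /cycle_edge ltnNge vn.
  (* [D_corner] excludes corners, and at [f d] both coordinates of [X] vanish. Off the image,
     [nbr_sum D v] being true forces [t v] to be false, so [X v] is false. *)
  have [/codomP[[j|j] vE]|vf] := boolP (v \in codom f).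
  - by case: (D_corner j); rewrite /corner -vE vD.
  - have jd : inr j = d by rewrite /d [j]ord1.
    move: (X1 d); rewrite vE jd nbr_sum_pred1 edge_sym nd /=.
    by case: ifP => _ [-> _].
  case: hD => _ /(_ v vf); have := X2 v vf.
  by case: (t v) => // _; rewrite vD.
rewrite negb_exists => /forallP nD.
have D0 v : nbr_sum D v = false by exact: negPf (nD v).
(* Now [D] is constant on the cycle and zero at a corner, hence zero at [f d], where exactly one of
   [D] and its neighbour sum should be true. *)
have [Dc _] := D_corner ord0.
have := hD.1 d; rewrite D0 nbr_sum_pred1 nd /= eqxx.
rewrite (cycle_P1_kernel D0 (inS _ (fS d)) (inS _ (fS (corner ord0)))) Dc.
by case: ifP.
Qed.

Theorem proposition6p2 :
  exists F : nat -> sgraph,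
    (forall n : nat, minimal_containing C3_P1 (F n)) /\
    (forall m n : nat, m <> n -> ~ isomorphic (F m) (F n)).
Proof.
exists cycle_P1; split=> [n|m n nmn [f bijf _]].
  split; first exact: has_pivot_minor_cycle_P1.
  exact: cycle_P1_proper_induced.
by apply: nmn; have := bij_eq_card bijf; rewrite !card_ord; clear; lia.
Qed.
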